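(* Let $R$ be a commutative ring, $G$ a group, $H$ an abelian subgroup of $G$ of index two, and let $A\mapsto\overline{A}$ be the conjugation on $RG$. Let $A,B,C,D\in RG$ and define $\alpha,\beta,\gamma\in RG$ by $$\begin{bmatrix}\alpha&\beta\\ \gamma&\overline{\alpha}\end{bmatrix}=\begin{bmatrix}A\overline{D}+B\overline{C}& A\overline{B}+B\overline{A}\\ C\overline{D}+D\overline{C}& D\overline{A}+C\overline{B}\end{bmatrix}$$ (the lower right entry $D\overline{A}+C\overline{B}$ is indeed the conjugate of $\alpha=A\overline{D}+B\overline{C}$). If $\alpha\overline{\alpha}-\beta\gamma$ is invertible in $RG$, then the matrix $\begin{bmatrix}A&B\\ C&D\end{bmatrix}$ is invertible over $RG$ and $$\begin{bmatrix}A&B\\ C&D\end{bmatrix}^{-1}=\begin{bmatrix}\overline{D}&\overline{B}\\ \overline{C}&\overline{A}\end{bmatrix}(\alpha\overline{\alpha}-\beta\gamma)^{-1}\begin{bmatrix}\overline{\alpha}&-\beta\\ -\gamma&\alpha\end{bmatrix}.$$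
   Context: $RG$ is the group algebra of $G$ over $R$ (finite formal sums $\sum_g a_g g$, $a_g\in R$). Let $T=\{e,t\}$ be a complete set of left coset representatives of $H$ in $G$, where $e$ is the unit element. Every element of $RG$ is uniquely of the form $\xi+t\eta$ with $\xi,\eta\in RH$, and its conjugate is defined by $\overline{\xi+t\eta}=t^{-1}\xi t-t\eta$. *)

(* Defs.v *)
From HB Require Import structures.
From mathcomp Require Import all_boot all_order all_algebra finmap.
From mathcomp.multinomials Require Import monalg.

Set Implicit Arguments.
Unset Strict Implicit.
Unset Printing Implicit Defensive.

Import GRing.Theory.

Local Open Scope fset_scope.
Local Open Scope ring_scope.

Reserved Notation "{ 'galg' R [ G ] }"
  (at level 0, R, G at level 2, format "{ 'galg'  R [ G ] }").

(* An alias is needed because [malg] is a ring only over a [monomType], in     *)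
(* which 1 is the only unit. [comPzRingType] allows the zero ring.             *)
Definition galg (R : comPzRingType) (G : groupType) := {malg R[G]}.

Notation "{ 'galg' R [ G ] }" := (@galg R G) : type_scope.
Bind Scope ring_scope with galg.

HB.instance Definition _ (R : comPzRingType) (G : groupType) :=
  GRing.Zmodule.on {galg R[G]}.

Section GroupAlgebra.
Variables (R : comPzRingType) (G : groupType).

Implicit Types (x y z : {galg R[G]}) (g h : G) (a b : R).

Definition gelt (g : G) : {galg R[G]} := << (1 : R) *g g >>.

Definition galg_mul x y : {galg R[G]} :=
  \sum_(g <- msupp x) \sum_(h <- msupp y) << x@_g * y@_h *g (g * h)%g >>.

Lemma galg_mulw (d1 d2 : {fset G}) x y :
  msupp x `<=` d1 -> msupp y `<=` d2 ->
  galg_mul x y = \sum_(g <- d1) \sum_(h <- d2) << x@_g * y@_h *g (g * h)%g >>.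
Proof.
move=> le_d1 le_d2; rewrite /galg_mul (big_fset_incl _ le_d1) /=.
  apply/eq_bigr=> k1 _; apply/big_fset_incl => // k _ /mcoeff_outdom ->.
  by rewrite mulr0 monalgU0.
move=> k _ /mcoeff_outdom g1k.
by rewrite big1 => // k' _; rewrite g1k mul0r monalgU0.
Qed.

Lemma galg_mulUU a b g h :
  galg_mul << a *g g >> << b *g h >> = << a * b *g (g * h)%g >>.
Proof.
by rewrite (galg_mulw (@msuppU_le _ _ _ _) (@msuppU_le _ _ _ _))
  !big_seq_fset1 !mcoeffUU.
Qed.

Lemma galg_mulDl : left_distributive galg_mul +%R.
Proof.
move=> x y z.
rewrite (galg_mulw (msuppD_le x y) (fsubset_refl _)).
rewrite (galg_mulw (fsubsetUl (msupp x) (msupp y)) (fsubset_refl _)).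
rewrite (galg_mulw (fsubsetUr (msupp x) (msupp y)) (fsubset_refl _)).
rewrite -big_split /=; apply/eq_bigr=> k1 _.
rewrite -big_split /=; apply/eq_bigr=> k2 _.
by rewrite mcoeffD mulrDl monalgUD.
Qed.

Lemma galg_mulDr : right_distributive galg_mul +%R.
Proof.
move=> z x y.
rewrite (galg_mulw (fsubset_refl _) (msuppD_le x y)).
rewrite (galg_mulw (fsubset_refl _) (fsubsetUl (msupp x) (msupp y))).
rewrite (galg_mulw (fsubset_refl _) (fsubsetUr (msupp x) (msupp y))).
rewrite -big_split /=; apply/eq_bigr=> k1 _.
rewrite -big_split /=; apply/eq_bigr=> k2 _.
by rewrite mcoeffD mulrDr monalgUD.
Qed.

Lemma galg_mul0x : left_zero 0 galg_mul.
Proof. by move=> x; rewrite /galg_mul msupp0 big_seq_fset0. Qed.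

Lemma galg_mulx0 : right_zero 0 galg_mul.
Proof.
by move=> x; rewrite /galg_mul big1 // => g _; rewrite msupp0 big_seq_fset0.
Qed.

Lemma galg_ind (P : {galg R[G]} -> Prop) :
  P 0 -> (forall x y, P x -> P y -> P (x + y)) ->
  (forall a g, P << a *g g >>) -> forall x, P x.
Proof. by move=> P0 PD PU x; rewrite [x]monalgE; elim/big_rec: _ => // *; apply: PD. Qed.

Lemma galg_mulA : associative galg_mul.
Proof.
elim/galg_ind=> [|x x' IHx IHx'|a g] y z; first by rewrite !galg_mul0x.
  by rewrite !galg_mulDl IHx IHx'.
elim/galg_ind: y => [|y y' IHy IHy'|b h]; first by rewrite galg_mul0x !galg_mulx0 galg_mul0x.
  by rewrite galg_mulDl !galg_mulDr galg_mulDl IHy IHy'.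
elim/galg_ind: z => [|z z' IHz IHz'|c k]; first by rewrite !galg_mulx0.
  by rewrite !galg_mulDr IHz IHz'.
by rewrite !galg_mulUU mulrA mulgA.
Qed.

Lemma galg_mul1x : left_id (gelt 1%g) galg_mul.
Proof.
elim/galg_ind=> [|x y IHx IHy|a g]; first by rewrite galg_mulx0.
  by rewrite galg_mulDr IHx IHy.
by rewrite galg_mulUU mul1r mul1g.
Qed.

Lemma galg_mulx1 : right_id (gelt 1%g) galg_mul.
Proof.
elim/galg_ind=> [|x y IHx IHy|a g]; first by rewrite galg_mul0x.
  by rewrite galg_mulDl IHx IHy.
by rewrite galg_mulUU mulr1 mulg1.
Qed.

HB.instance Definition _ := GRing.Zmodule_isPzRing.Build {galg R[G]}
  galg_mulA galg_mul1x galg_mulx1 galg_mulDl galg_mulDr.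

Lemma galgUM a b g h :
  (<< a *g g >> : {galg R[G]}) * (<< b *g h >> : {galg R[G]}) =
  << a * b *g (g * h)%g >>.
Proof. exact: galg_mulUU. Qed.

Lemma geltM g h : gelt (g * h)%g = gelt g * gelt h.
Proof. by rewrite galgUM mulr1. Qed.

Lemma gelt1 : gelt 1%g = 1.
Proof. by []. Qed.

Definition supported (H : {pred G}) x := {subset msupp x <= H}.

Definition restrict (H : {pred G}) x : {galg R[G]} :=
  \sum_(g <- msupp x | g \in H) << x@_g *g g >>.

End GroupAlgebra.

Arguments gelt {R G} g.

(* [T] lists each left coset of [H] exactly once.                              *)
Definition left_transversal (G : groupType) (H : {pred G}) (T : seq G) : Prop :=
  uniq T /\ forall g : G, exists! x : G, x \in T /\ (x^-1 * g)%g \in H.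

Definition has_index (G : groupType) (H : {pred G}) (n : nat) : Prop :=
  exists T : seq G, size T = n /\ left_transversal H T.

Section Conjugate.
Variables (R : comPzRingType) (G : groupType).

Implicit Types (H : groupClosed G) (t g : G) (x xi eta : {galg R[G]}).

(* The coordinates of x = xi + t eta with xi, eta in RH; see [coordsE],        *)
(* [coords_supported] and [coords_unique].                                     *)
Definition coord_e H x : {galg R[G]} := restrict H x.
Definition coord_t H t x : {galg R[G]} := gelt t^-1%g * (x - restrict H x).

Definition conjugate H t x : {galg R[G]} :=
  gelt t^-1%g * coord_e H x * gelt t - gelt t * coord_t H t x.

Lemma restrict_coef (H : {pred G}) x g :
  (restrict H x)@_g = if g \in H then x@_g else 0.
Proof.
rewrite /restrict raddf_sum /=; under eq_bigr do rewrite mcoeffU.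
have [gx|gx] := msuppP x g; last first.
  rewrite big_seq_cond big1 ?if_same // => h /andP[hx _].
  by case: eqP hx gx => // -> ->.
rewrite big_mkcond (bigD1_seq g) ?fset_uniq //= eqxx mulr1n big1 ?addr0 //.
by move=> h /negbTE->; rewrite mulr0n if_same.
Qed.

Lemma supportedP (H : {pred G}) x :
  supported H x <-> (forall g, g \notin H -> x@_g = 0).
Proof.
split=> [sHx g gH | sHx g]; first by apply/mcoeff_outdom/(contra (sHx g)).
by rewrite -mcoeff_neq0; apply: contraR => /sHx ->.
Qed.

Lemma gelt_mul_coef t x g : (gelt t * x)@_g = x@_(t^-1 * g)%g.
Proof.
elim/galg_ind: x => [|x y IHx IHy|a h]; first by rewrite mulr0 !mcoeff0.
  by rewrite mulrDr !mcoeffD IHx IHy.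
rewrite galgUM mul1r !mcoeffU; congr (_ *+ nat_of_bool _).
by apply/eqP/eqP=> [<-|->]; rewrite ?mulKg ?mulVKg.
Qed.

Lemma geltKV t : cancel ( *%R (gelt t) : {galg R[G]} -> _) ( *%R (gelt t^-1%g)).
Proof. by move=> x; rewrite mulrA -geltM mulVg mul1r. Qed.

Lemma geltVK t : cancel ( *%R (gelt t^-1%g) : {galg R[G]} -> _) ( *%R (gelt t)).
Proof. by move=> x; rewrite mulrA -geltM mulgV mul1r. Qed.

Lemma transversal_xor H t g :
  left_transversal H [:: 1%g; t] -> ((t^-1 * g)%g \in H) = (g \notin H).
Proof.
move=> [] /=; rewrite inE andbT => t1 /(_ g)[x [[xT xH] Ux]].
have [gH|gH] := boolP (g \in H); last first.
  by move: xT xH; rewrite !inE => /orP[]/eqP-> //; rewrite invg1 mul1g (negbTE gH).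
apply/negP => tgH; case/eqP: t1; rewrite -[LHS]Ux -?[RHS]Ux //.
  by rewrite !inE eqxx orbT.
by rewrite !inE eqxx invg1 mul1g.
Qed.

Lemma coordsE H t x : x = coord_e H x + gelt t * coord_t H t x.
Proof. by rewrite /coord_t geltVK addrC subrK. Qed.

Lemma coords_supported H t x : left_transversal H [:: 1%g; t] ->
  supported H (coord_e H x) /\ supported H (coord_t H t x).
Proof.
move=> tT; split; apply/supportedP => g gH.
  by rewrite restrict_coef (negbTE gH).
rewrite gelt_mul_coef invgK mcoeffB restrict_coef.
by rewrite -[_ \in H]negbK -(transversal_xor _ tT) mulKg gH subrr.
Qed.

Lemma coords_unique H t xi eta : left_transversal H [:: 1%g; t] ->
  supported H xi -> supported H eta ->
  coord_e H (xi + gelt t * eta) = xi /\ coord_t H t (xi + gelt t * eta) = eta.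
Proof.
move=> tT /supportedP sxi /supportedP seta.
have e1 : coord_e H (xi + gelt t * eta) = xi.
  apply/malgP => g; rewrite restrict_coef mcoeffD gelt_mul_coef.
  case: ifPn => [gH|/sxi-> //].
  by rewrite [eta@__]seta ?addr0 // (transversal_xor _ tT) gH.
split=> //; rewrite /coord_t -/(coord_e _ _) e1.
by rewrite [xi + _]addrC addrK geltKV.
Qed.

Lemma conjugateE H t xi eta : left_transversal H [:: 1%g; t] ->
  supported H xi -> supported H eta ->
  conjugate H t (xi + gelt t * eta) = gelt t^-1%g * xi * gelt t - gelt t * eta.
Proof.
by move=> tT sxi seta; rewrite /conjugate; have [-> ->] := coords_unique tT sxi seta.
Qed.

End Conjugate.

Definition is_inverse (S : pzRingType) (x y : S) : Prop := x * y = 1 /\ y * x = 1.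

Definition invertible (S : pzRingType) (x : S) : Prop := exists y, is_inverse x y.

Definition mx22 (S : pzRingType) (a b c d : S) : 'M[S]_2 :=
  \matrix_(i, j) if i == 0 then (if j == 0 then a else b)
                 else (if j == 0 then c else d).

(* Main.v *)
(* Conjugation is an anti-automorphic involution of RG whose traces x + cj x    *)
(* and norms x cj x are central. For M = [A, B; C, D], let N be the conjugate   *)
(* transpose of M with both indices reversed. Then M N = [alpha, beta; gamma,   *)
(* cj alpha] has beta and gamma central, so its adjugate inverts it up to the   *)
(* central factor delta; this gives the right inverse. As RG is not             *)
(* commutative, the left inverse needs its own argument: N M has the same       *)
(* shape, and its determinant is again delta, because delta expands to          *)
(* n(A) n(D) + n(B) n(C) - tr(A cj(C) D cj(B)), with n the norm, and traces     *)
(* are invariant under cyclic shifts.                                           *)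

Require Import Defs.
From mathcomp Require Import all_boot all_order all_algebra finmap.
From mathcomp.multinomials Require Import monalg.

Import GRing.Theory.

Local Open Scope ring_scope.

(** The matrix formula rests only on the axioms in [scalar_involution]: [mx22_inverse] derives it
    from them, and [qdet_conj] equates the determinants of M N and N M. Conjugation on RG satisfies
    the axioms ([conjugate_scalar]) because RG = RH + t RH with RH commutative, t^2 in RH, and x ->
    t^-1 x t an involution of RH, so that [twisted_scalar_involution] applies. There the trace and
    norm of a + u b are a + s(a) and a s(a) - u^2 s(b) b; both lie in K and are fixed by s, which
    makes them central. *)

(** * Two-by-two matrices and central scalars *)

Section Matrices.
Variable S : pzRingType.
Implicit Types a b c d e : S.

Lemma mx22M a b c d a' b' c' d' :
  mx22 a b c d *m mx22 a' b' c' d' =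
  mx22 (a * a' + b * c') (a * b' + b * d') (c * a' + d * c') (c * b' + d * d').
Proof.
by apply/matrixP => i j; rewrite !mxE !big_ord_recl big_ord0 !mxE /= addr0;
  case: ifP; case: ifP.
Qed.

Lemma mx22_scalar e : mx22 e 0 0 e = e%:M.
Proof.
by apply/matrixP => [[[|[|//]] i] [[|[|//]] j]]; rewrite !mxE.
Qed.

Lemma mulmx_scaleC m n p e (X : 'M[S]_(m, n)) (Y : 'M[S]_(n, p)) :
  (forall a, e * a = a * e) -> X *m (e *: Y) = e *: (X *m Y).
Proof.
move=> eC; apply/matrixP => i j; rewrite !mxE mulr_sumr.
by apply: eq_bigr => k _; rewrite !mxE !mulrA eC.
Qed.

(** Inserting d e = 1 gives e a = e a d e = e d a e = a e. *)
Lemma central_inverse d e :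
  is_inverse d e -> (forall a, d * a = a * d) -> forall a, e * a = a * e.
Proof.
move=> [de ed] dC a.
rewrite -[LHS]mulr1 -de -[e * a * _]mulrA [a * _]mulrA -dC.
by rewrite -mulrA mulrA ed mul1r.
Qed.

Lemma inverse_of_left_right (x y z : S) : x * y = 1 -> z * x = 1 -> is_inverse x y.
Proof.
move=> xy zx; split=> //.
by rewrite -[y]mul1r -zx -[z * x * y]mulrA xy mulr1.
Qed.

End Matrices.

(** * Involutions with central traces and norms *)

Record scalar_involution (S : pzRingType) (cj : S -> S) : Prop := {
  scjD : {morph cj : x y / x + y};
  scjM : forall x y, cj (x * y) = cj y * cj x;
  scjK : involutive cj;
  trace_central : forall x y, (x + cj x) * y = y * (x + cj x);
  norm_central : forall x y, (x * cj x) * y = y * (x * cj x)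
}.

Section ScalarInvolution.
Set Implicit Arguments.
Unset Strict Implicit.
Variables (S : pzRingType) (cj : S -> S).
Hypothesis cjP : scalar_involution S cj.
Let cjD := scjD _ _ cjP.
Let cjM := scjM _ _ cjP.
Let cjK := scjK _ _ cjP.
Let trC := trace_central _ _ cjP.
Let nC := norm_central _ _ cjP.

Implicit Types x y z A B C D : S.

(** The trace x + [cj x] commutes with x. *)
Lemma mul_conjC x : x * cj x = cj x * x.
Proof. by apply: (addrI (x * x)); rewrite -mulrDr -trC mulrDl. Qed.

(** The sum is the trace of x [cj y]. *)
Lemma polar_central x y z : (x * cj y + y * cj x) * z = z * (x * cj y + y * cj x).
Proof. by have := trC (x * cj y) z; rewrite cjM cjK. Qed.

(** Polarization of [mul_conjC]: expand it at x + y and cancel the two norms. *)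
Lemma polarC x y : x * cj y + y * cj x = cj y * x + cj x * y.
Proof.
have := mul_conjC (x + y); rewrite cjD !(mulrDl, mulrDr) -!mul_conjC.
rewrite -!addrA => /addrI; rewrite !addrA => /addIr.
by rewrite [RHS]addrC.
Qed.

(* The determinant delta of M N for M = [A, B; C, D]. *)
Definition qdet A B C D : S :=
  (A * cj D + B * cj C) * cj (A * cj D + B * cj C)
  - (A * cj B + B * cj A) * (C * cj D + D * cj C).

Lemma qdet_central A B C D z : qdet A B C D * z = z * qdet A B C D.
Proof.
rewrite /qdet mulrBl mulrBr nC; congr (_ - _).
by rewrite -mulrA (polar_central C D) !mulrA (polar_central A B).
Qed.

Lemma qdetE A B C D :
  qdet A B C D = (A * cj A) * (D * cj D) + (B * cj B) * (C * cj C)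
    - (A * cj C * D * cj B + B * cj D * C * cj A).
Proof.
(* Centrality of C [cj D] + D [cj C] lets the cross terms of the norm of alpha be traded for those
   of the trace; what is left over is exactly beta gamma, which cancels. *)
have swap x y : x * cj D * C * cj y =
    x * cj y * (C * cj D + D * cj C) - x * cj C * D * cj y.
  apply/(canRL (addrK _)); rewrite -[x * cj y * _]mulrA -polar_central polarC.
  by rewrite mulrDl mulrDr !mulrA.
have swap' x y : x * cj C * D * cj y =
    x * cj y * (C * cj D + D * cj C) - x * cj D * C * cj y.
  by rewrite swap opprB addrC subrK.
rewrite /qdet cjD !cjM !cjK mulrDl 2!mulrDr !mulrA swap (swap' B A).
have norms x y : x * cj y * y * cj x = x * cj x * y * cj y.
  by rewrite -(mulrA x) -mul_conjC -nC -[LHS]mulrA nC !mulrA.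
rewrite !norms mulrDl !opprD !addrA.
rewrite [LHS](ACl (1*6*3*5*2*7*4*8)%AC). by rewrite /= !addrK.
Qed.

(** In the expansion [qdetE], norms are unchanged by conjugation, and [polarC] moves [cj B]
    cyclically to the front of the trace term. *)
Lemma qdet_conj A B C D : qdet (cj D) (cj B) (cj C) (cj A) = qdet A B C D.
Proof.
rewrite !qdetE !cjK -!mul_conjC nC; congr (_ - _).
have := polarC (A * cj C * D) B; rewrite !cjM cjK !mulrA => ->.
by rewrite addrC.
Qed.

(** The commutative adjugate computation survives: b and c are central, and a commutes with
    [cj a]. *)
Lemma mx22_adj_right a b c :
  (forall x, b * x = x * b) -> (forall x, c * x = x * c) ->
  mx22 a b c (cj a) *m mx22 (cj a) (- b) (- c) a = (a * cj a - b * c)%:M.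
Proof.
move=> bC cC; rewrite mx22M -mx22_scalar; congr (mx22 _ _ _ _).
- by rewrite mulrN.
- by rewrite mulrN bC addNr.
- by rewrite mulrN cC subrr.
- by rewrite mulrN -mul_conjC bC addrC.
Qed.

Lemma mx22_adj_left a b c :
  (forall x, b * x = x * b) -> (forall x, c * x = x * c) ->
  mx22 (cj a) (- b) (- c) a *m mx22 a b c (cj a) = (a * cj a - b * c)%:M.
Proof.
move=> bC cC; rewrite mx22M -mx22_scalar; congr (mx22 _ _ _ _).
- by rewrite mulNr mul_conjC.
- by rewrite mulNr bC subrr.
- by rewrite mulNr cC addNr.
- by rewrite mulNr bC addrC.
Qed.

Lemma conj_diag A B C D : cj (A * cj D + B * cj C) = D * cj A + C * cj B.
Proof. by rewrite cjD !cjM !cjK. Qed.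

Lemma mx22_inverse A B C D e (alpha := A * cj D + B * cj C)
    (beta := A * cj B + B * cj A) (gamma := C * cj D + D * cj C) :
  is_inverse (alpha * cj alpha - beta * gamma) e ->
  is_inverse (mx22 A B C D)
    (mx22 (cj D) (cj B) (cj C) (cj A)
     *m (e *: mx22 (cj alpha) (- beta) (- gamma) alpha)).
Proof.
move=> eP; have eC := central_inverse _ _ _ eP (qdet_central A B C D).
have [_ ed] := eP.
(* The entries of N M, playing the roles of alpha, beta and gamma. *)
pose alpha' := cj D * A + cj B * C.
pose beta' := cj D * B + cj B * D; pose gamma' := cj C * A + cj A * C.
have beta'C z : beta' * z = z * beta'.
  by have := polar_central (cj D) (cj B) z; rewrite !cjK.
have gamma'C z : gamma' * z = z * gamma'.
  by have := polar_central (cj C) (cj A) z; rewrite !cjK.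
have det' : alpha' * cj alpha' - beta' * gamma' = qdet A B C D.
  by rewrite -qdet_conj /qdet !cjK.
(* The left inverse is e adj(N M) N; it then has to agree with the right inverse N e adj(M N). *)
apply: (@inverse_of_left_right _ _ _
  (e *: mx22 (cj alpha') (- beta') (- gamma') alpha'
     *m mx22 (cj D) (cj B) (cj C) (cj A))).
- rewrite -[LHS]/(_ *m _) mulmxA mulmx_scaleC // mx22M.
  rewrite [C * cj B + _]addrC -(conj_diag A B C D).
  rewrite mx22_adj_right; try exact: polar_central.
  by rewrite scale_scalar_mx ed.
- have conj_alpha' : cj C * B + cj A * D = cj alpha'.
    by rewrite cjD !cjM !cjK addrC.
  rewrite -[LHS]/(_ *m _) -mulmxA mx22M conj_alpha' -scalemxAl.
  by rewrite mx22_adj_left // det' scale_scalar_mx ed.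
Qed.

End ScalarInvolution.

(* A ring S = K + uK with K commutative, conjugation by u an involution [s] of  *)
(* K, and u^2 in K.                                                             *)
Section TwistedExtension.
Set Implicit Arguments.
Unset Strict Implicit.
Variables (S : pzRingType) (K : S -> Prop) (u : S) (s cj : S -> S).
Hypotheses (KD : forall a b, K a -> K b -> K (a + b))
  (KN : forall a, K a -> K (- a))
  (KM : forall a b, K a -> K b -> K (a * b))
  (KC : forall a b, K a -> K b -> a * b = b * a).
Hypotheses (Ku2 : K (u * u)) (Ks : forall a, K a -> K (s a)).
Hypotheses (sD : {morph s : a b / a + b}) (sM : {morph s : a b / a * b})
  (sK : forall a, K a -> s (s a) = a) (su2 : s (u * u) = u * u)
  (mul_u : forall a, a * u = u * s a).
Hypotheses (decomp : forall x, exists a b, [/\ K a, K b & x = a + u * b])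
  (cjE : forall a b, K a -> K b -> cj (a + u * b) = s a - u * b).

Let sN a : s (- a) = - s a.
Proof.
have s0 : s 0 = 0 by apply: (addrI (s 0)); rewrite -sD !addr0.
by apply/(addrI (s a)); rewrite -sD !subrr.
Qed.

Let mul_coords a b c d :
  (a + u * b) * (c + u * d) = a * c + u * u * (s b * d) + u * (s a * d + b * c).
Proof.
rewrite mulrDl !mulrDr !mulrA mul_u -[u * b * u]mulrA mul_u !mulrA.
by rewrite -!addrA; congr (_ + _); rewrite addrA addrC.
Qed.

(** Such an element commutes with K, and with u because u acts on K through s. *)
Let central_fixed a : K a -> s a = a -> forall x, a * x = x * a.
Proof.
move=> Ka sa x; have [c [d [Kc Kd ->]]] := decomp x.
rewrite mulrDr mulrDl mulrA mul_u sa (KC Ka Kc).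
by rewrite -!mulrA (KC Ka Kd).
Qed.

Lemma twisted_scalar_involution : scalar_involution S cj.
Proof.
have Kw a b : K a -> K b -> K (u * u * (s a * b))
  by move=> Ka Kb; do !apply: KM => //; exact: Ks.
split=> [x y|x y|x|x|x].
- have [a [b [Ka Kb ->]]] := decomp x; have [c [d [Kc Kd ->]]] := decomp y.
  rewrite addrACA -mulrDr !cjE //; try exact: KD.
  by rewrite sD mulrDr opprD addrACA.
- have [a [b [Ka Kb ->]]] := decomp x; have [c [d [Kc Kd ->]]] := decomp y.
  have [Ksa Ksb Ksc Ksd] := And4 (Ks Ka) (Ks Kb) (Ks Kc) (Ks Kd).
  rewrite mul_coords !cjE -?[in RHS]mulrN ?mul_coords //; last 2 first.
  + by apply: KD (KM Ka Kc) (Kw _ _ Kb Kd).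
  + by apply: KD; apply: KM.
  rewrite sD (sM a) (sM (u * u)) su2 (sM (s b)) !sK // sN.
  rewrite !(mulrN, mulNr) opprK -opprD mulrN.
  by rewrite (KC Ksa Ksc) (KC Ksd Kb) (KC Ksa Kd) (KC Kb Kc) [d * _ + _]addrC.
- have [a [b [Ka Kb ->]]] := decomp x.
  rewrite cjE // -mulrN cjE ?sK ?mulrN ?opprK //; [exact: Ks | exact: KN].
- have [a [b [Ka Kb ->]]] := decomp x; rewrite cjE // addrACA subrr.
  rewrite addr0; apply: central_fixed; first exact: KD Ka (Ks Ka).
  by rewrite sD sK // addrC.
- have [a [b [Ka Kb ->]]] := decomp x; rewrite cjE // -mulrN mul_coords.
  have [Ksa Ksb] := conj (Ks Ka) (Ks Kb).
  rewrite [b * s a]KC // !mulrN addNr mulr0 addr0; apply: central_fixed.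
    by apply: KD; [exact: KM | apply/KN/Kw].
  by rewrite sD sN (sM (u * u)) su2 !sM !sK // (KC Ksa Ka) (KC Kb Ksb).
Qed.

End TwistedExtension.

(** * Conjugation on the group algebra *)

Section Conjugation.
Set Implicit Arguments.
Unset Strict Implicit.
Variables (R : comPzRingType) (G : groupType) (H : groupClosed G) (t : G).
Hypothesis H_abelian : forall g h : G, g \in H -> h \in H -> (g * h)%g = (h * g)%g.
Hypothesis tT : left_transversal H [:: 1%g; t].

Local Notation RG := {galg R[G]}.
Implicit Types (x y : RG) (g h : G).

Lemma supportedD x y : supported H x -> supported H y -> supported H (x + y).
Proof.
move=> /supportedP sx /supportedP sy; apply/supportedP => g gH.
by rewrite mcoeffD sx // sy // addr0.
Qed.

Lemma supported_gelt a g : g \in H -> supported H (<< a *g g >> : RG).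
Proof.
move=> gH; apply/supportedP => h; rewrite mcoeffU.
by case: eqP => // <-; rewrite gH.
Qed.

Lemma supported_ind (P : RG -> Prop) :
  P 0 -> (forall x y, P x -> P y -> P (x + y)) ->
  (forall a g, g \in H -> P << a *g g >>) -> forall x, supported H x -> P x.
Proof.
move=> P0 PD PU x sx; rewrite [x]monalgE big_seq.
by elim/big_rec: _ => // g y gx Py; apply: PD => //; apply/PU/sx.
Qed.

Lemma supported0 : supported H (0 : RG).
Proof. by apply/supportedP => g _; rewrite mcoeff0. Qed.

Lemma supportedM x y : supported H x -> supported H y -> supported H (x * y).
Proof.
move: x; apply: supported_ind => [|x x' IHx IHx' sy|a g gH].
- by rewrite mul0r => _; exact: supported0.
- by rewrite mulrDl; apply: supportedD; [exact: IHx | exact: IHx'].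
move: y; apply: supported_ind => [|y y' IHy IHy'|b h hH].
- by rewrite mulr0; exact: supported0.
- by rewrite mulrDr; apply: supportedD.
by rewrite galgUM; apply/supported_gelt/gpredM.
Qed.

Lemma supportedC x y : supported H x -> supported H y -> x * y = y * x.
Proof.
move: x; apply: supported_ind => [|x x' IHx IHx' sy|a g gH].
- by rewrite mul0r mulr0.
- by rewrite mulrDl mulrDr IHx // IHx'.
move: y; apply: supported_ind => [|y y' IHy IHy'|b h hH].
- by rewrite mul0r mulr0.
- by rewrite mulrDl mulrDr IHy IHy'.
by rewrite !galgUM mulrC H_abelian.
Qed.

Lemma notin_t : t \notin H.
Proof. by rewrite -(transversal_xor _ tT) mulVg gpred1. Qed.

Lemma sqr_in : (t * t)%g \in H.
Proof. by rewrite -[_ \in _]negbK -(transversal_xor _ tT) mulKg notin_t. Qed.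

(** Normality of a subgroup of index two: t^-1 (g t) lies in H unless g t does, and the latter would
    put t in H. *)
Lemma conj_in g : g \in H -> (t^-1 * g * t)%g \in H.
Proof.
move=> gH; rewrite -mulgA (transversal_xor _ tT).
apply: contra notin_t => gtH.
by rewrite -(mulKg g t) gpredM ?gpredV.
Qed.

Lemma conjugate_scalar : scalar_involution {galg R[G]} (@conjugate R G H t).
Proof.
pose u : {galg R[G]} := gelt t; pose v : {galg R[G]} := gelt t^-1%g.
have uv : u * v = 1 by rewrite -geltM mulgV.
have vu : v * u = 1 by rewrite -geltM mulVg.
have Ku2 : supported H (u * u) by rewrite -geltM; apply/supported_gelt/sqr_in.
apply: (@twisted_scalar_involution _ (supported H) u (fun x => v * x * u)) => //.
- exact: supportedD.
- by move=> a /supportedP sa; apply/supportedP => g gH; rewrite mcoeffN sa ?oppr0.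
- exact: supportedM.
- exact: supportedC.
- apply: supported_ind => [|x y|a g gH].
  + by rewrite mulr0 mul0r; exact: supported0.
  + by rewrite mulrDr mulrDl; exact: supportedD.
  + by rewrite !galgUM; apply/supported_gelt/conj_in.
- by move=> a b; rewrite mulrDr mulrDl.
- by move=> a b; rewrite -!mulrA (mulrA u v) uv mul1r.
(* Applying s twice conjugates by t^2, which lies in H and hence commutes with RH. *)
- move=> a sa; rewrite -!mulrA (supportedC sa Ku2) -mulrA (mulrA v u) vu.
  by rewrite mul1r mulrA vu mul1r.
- by rewrite !mulrA vu mul1r.
- by move=> a; rewrite !mulrA uv mul1r.
- move=> x; have [] := coords_supported x tT.
  by exists (coord_e H x), (coord_t H t x); split=> //; exact: coordsE.
- by move=> a b; exact: conjugateE.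
Qed.

End Conjugation.

Theorem theorem34 (R : comPzRingType) (G : groupType) (H : groupClosed G)
  (H_abelian : forall g h : G, g \in H -> h \in H -> (g * h)%g = (h * g)%g)
  (H_index2 : has_index H 2)
  (t : G) (T_transversal : left_transversal H [:: 1%g; t])
  (A B C D : {galg R[G]}) :
  let cj := @conjugate R G H t in
  let alpha := A * cj D + B * cj C in
  let beta := A * cj B + B * cj A in
  let gamma := C * cj D + D * cj C in
  let delta := alpha * cj alpha - beta * gamma in
  mx22 alpha beta gamma (cj alpha) =
    mx22 (A * cj D + B * cj C) (A * cj B + B * cj A)
         (C * cj D + D * cj C) (D * cj A + C * cj B)
  /\ (invertible delta ->
      invertible (mx22 A B C D)
      /\ (forall delta_inv : {galg R[G]}, is_inverse delta delta_inv ->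
            is_inverse (mx22 A B C D)
              (mx22 (cj D) (cj B) (cj C) (cj A)
               *m (delta_inv *: mx22 (cj alpha) (- beta) (- gamma) alpha)))).
Proof.
move=> cj alpha beta gamma delta.
have cjP := conjugate_scalar R H_abelian T_transversal.
have inv e := mx22_inverse cjP (A := A) (B := B) (C := C) (D := D) (e := e).
split; first by rewrite /alpha /cj (conj_diag cjP).
by move=> [e eP]; split=> [|e' e'P]; [eexists; exact: inv eP | exact: inv e'P].
Qed.
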